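(* The group $\Gamma_{353}$ is an $\mathcal{RP}$ group; that is, there exist $f,g\in\mathrm{PSL}(2,\mathbb{C})$ with $\Gamma_{353}=\langle f,g\rangle$ such that $\mathrm{tr}^2f-4$, $\mathrm{tr}^2g-4$ and $\mathrm{tr}[f,g]-2$ are all real.
   Context: Let $T$ be the compact hyperbolic tetrahedron in $\mathbb{H}^3$ with Coxeter diagram 3--5--3: its faces can be labelled $F_1,F_2,F_3,F_4$ so that the dihedral angles between $F_1$ and $F_2$, $F_2$ and $F_3$, $F_3$ and $F_4$ are $\pi/3$, $\pi/5$, $\pi/3$, respectively, and all other dihedral angles are $\pi/2$. Let $G_T$ be the group generated by reflections in the faces of $T$ and let $\Delta_T$ be its orientation preserving subgroup of index 2. Let $e$ be the half-turn (rotation by $\pi$) whose axis is orthogonal to the two opposite edges of $T$ with dihedral angles $\pi/2$ (the edge $F_1\cap F_4$) and $\pi/5$ (the edge $F_2\cap F_3$). Then $\Gamma_{353}=\langle\Delta_T,e\rangle\subset\mathrm{PSL}(2,\mathbb{C})$, where $\mathrm{PSL}(2,\mathbb{C})$ is identified with the group of orientation preserving isometries of $\mathbb{H}^3$. The class of $\mathcal{RP}$ groups is $$\mathcal{RP}=\{\langle f,g\rangle \mid f,g\in\mathrm{PSL}(2,\mathbb{C});\ \mathrm{tr}^2f-4,\ \mathrm{tr}^2g-4,\ \mathrm{tr}[f,g]-2\in\mathbb{R}\},$$ where $[f,g]=fgf^{-1}g^{-1}$. *)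

(* Defs.v *)
From HB Require Import structures.
From mathcomp Require Import all_boot all_order all_algebra.
From mathcomp Require Import complex.
From mathcomp Require Import boolp classical_sets reals trigo.

Set Implicit Arguments.
Unset Strict Implicit.
Unset Printing Implicit Defensive.

Import Order.TTheory GRing.Theory Num.Theory.

Local Open Scope classical_set_scope.
Local Open Scope quotient_scope.
Local Open Scope sesquilinear_scope.
Local Open Scope ring_scope.

Section GeneratedSubgroup.
Variable G : groupType.
Local Open Scope group_scope.

Definition is_subgroup (H : set G) : Prop :=
  H 1 /\ forall x y, H x -> H y -> H (x / y).

Definition gen (S : set G) : set G := smallest is_subgroup S.

End GeneratedSubgroup.

Section SL2.
Variable R : realType.

Record SL2 := MkSL2 { SL2val :> 'M[R[i]]_2; _ : \det SL2val == 1 }.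
HB.instance Definition _ := [isSub for SL2val].
HB.instance Definition _ := [Choice of SL2 by <:].

Implicit Types A B : SL2.

Lemma det_SL2 A : \det A = 1. Proof. exact/eqP/(valP A). Qed.

Lemma SL2_unit A : val A \in unitmx.
Proof. by rewrite unitmxE det_SL2 unitr1. Qed.

Lemma SL2one_subproof : \det (1%:M : 'M[R[i]]_2) == 1.
Proof. by rewrite det1. Qed.
Lemma SL2inv_subproof A : \det (invmx A) == 1.
Proof. by rewrite det_inv det_SL2 invr1. Qed.
Lemma SL2mul_subproof A B : \det (A *m B) == 1.
Proof. by rewrite det_mulmx !det_SL2 mulr1. Qed.
Lemma SL2opp_subproof A : \det (- val A) == 1.
Proof. by rewrite -scaleN1r detZ det_SL2 mulr1 sqrrN expr1n. Qed.

Definition SL2one := MkSL2 SL2one_subproof.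
Definition SL2inv A := MkSL2 (SL2inv_subproof A).
Definition SL2mul A B := MkSL2 (SL2mul_subproof A B).
Definition SL2opp A := MkSL2 (SL2opp_subproof A).

Lemma SL2mulA : associative SL2mul.
Proof. by move=> A B D; apply: val_inj; rewrite /= mulmxA. Qed.
Lemma SL2mul1 : left_id SL2one SL2mul.
Proof. by move=> A; apply: val_inj; rewrite /= mul1mx. Qed.
Lemma SL2mulr1 : right_id SL2one SL2mul.
Proof. by move=> A; apply: val_inj; rewrite /= mulmx1. Qed.
Lemma SL2mulV : left_inverse SL2one SL2inv SL2mul.
Proof. by move=> A; apply: val_inj; rewrite /= mulVmx// SL2_unit. Qed.
Lemma SL2mulrV : right_inverse SL2one SL2inv SL2mul.
Proof. by move=> A; apply: val_inj; rewrite /= mulmxV// SL2_unit. Qed.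

HB.instance Definition _ :=
  isGroup.Build SL2 SL2mulA SL2mul1 SL2mulr1 SL2mulV SL2mulrV.

Definition eq_pm A B := (A == B) || (A == SL2opp B).

Lemma SL2oppK : involutive SL2opp.
Proof. by move=> A; apply: val_inj; rewrite /= opprK. Qed.

Lemma eq_pm_refl : reflexive eq_pm.
Proof. by move=> A; rewrite /eq_pm eqxx. Qed.
Lemma eq_pm_sym : symmetric eq_pm.
Proof.
by move=> A B; rewrite /eq_pm eq_sym; congr (_ || _);
  rewrite eq_sym (can2_eq SL2oppK SL2oppK).
Qed.
Lemma eq_pm_trans : transitive eq_pm.
Proof.
by move=> B A D /orP[]/eqP-> /orP[]/eqP->;
  rewrite /eq_pm ?SL2oppK eqxx ?orbT.
Qed.
Canonical eq_pm_equiv := EquivRel eq_pm eq_pm_refl eq_pm_sym eq_pm_trans.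

Definition PSL2 := {eq_quot eq_pm_equiv}.
HB.instance Definition _ := Choice.on PSL2.
HB.instance Definition _ := EqQuotient.on PSL2.

Lemma PSL2_eqP A B : reflect (A = B \/ A = SL2opp B) (\pi_PSL2 A == \pi_PSL2 B).
Proof.
rewrite eqmodE; apply: (iffP orP) => -[]; first by move/eqP; left.
- by move/eqP; right.
- by move=> ->; left.
- by move=> ->; right.
Qed.

Lemma repr_PSL2 A : repr (\pi_PSL2 A) = A \/ repr (\pi_PSL2 A) = SL2opp A.
Proof. by apply/PSL2_eqP; rewrite reprK. Qed.

Definition PSL2one : PSL2 := \pi_PSL2 SL2one.
Definition PSL2inv (a : PSL2) : PSL2 := \pi_PSL2 (SL2inv (repr a)).
Definition PSL2mul (a b : PSL2) : PSL2 := \pi_PSL2 (SL2mul (repr a) (repr b)).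

Lemma SL2mulNl A B : SL2mul (SL2opp A) B = SL2opp (SL2mul A B).
Proof. by apply: val_inj; rewrite /= mulNmx. Qed.
Lemma SL2mulNr A B : SL2mul A (SL2opp B) = SL2opp (SL2mul A B).
Proof. by apply: val_inj; rewrite /= mulmxN. Qed.
Lemma SL2invN A : SL2inv (SL2opp A) = SL2opp (SL2inv A).
Proof.
apply: val_inj => /=; have [uA uN] := (SL2_unit A, SL2_unit (SL2opp A)).
by apply: (can_inj (mulKmx uN)); rewrite mulmxV// mulmxN mulNmx opprK mulmxV.
Qed.
Lemma pi_SL2opp A : \pi_PSL2 (SL2opp A) = \pi_PSL2 A.
Proof. by apply/eqP/PSL2_eqP; right. Qed.

Lemma PSL2mul_pi A B : PSL2mul (\pi_PSL2 A) (\pi_PSL2 B) = \pi_PSL2 (SL2mul A B).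
Proof.
rewrite /PSL2mul; case: (repr_PSL2 A) => ->; case: (repr_PSL2 B) => ->;
  by rewrite ?SL2mulNl ?SL2mulNr ?pi_SL2opp.
Qed.
Lemma PSL2inv_pi A : PSL2inv (\pi_PSL2 A) = \pi_PSL2 (SL2inv A).
Proof.
by rewrite /PSL2inv; case: (repr_PSL2 A) => ->; rewrite ?SL2invN ?pi_SL2opp.
Qed.

Lemma PSL2mulA : associative PSL2mul.
Proof.
move=> a b c; rewrite -[a]reprK -[b]reprK -[c]reprK.
set A := repr a; set B := repr b; set D := repr c.
by rewrite (PSL2mul_pi B D) (PSL2mul_pi A B) !(PSL2mul_pi, SL2mulA).
Qed.
Lemma PSL2mul1 : left_id PSL2one PSL2mul.
Proof. by move=> a; rewrite -[a]reprK PSL2mul_pi SL2mul1. Qed.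
Lemma PSL2mulr1 : right_id PSL2one PSL2mul.
Proof. by move=> a; rewrite -[a]reprK PSL2mul_pi SL2mulr1. Qed.
Lemma PSL2mulV : left_inverse PSL2one PSL2inv PSL2mul.
Proof. by move=> a; rewrite -[a]reprK PSL2inv_pi PSL2mul_pi SL2mulV. Qed.
Lemma PSL2mulrV : right_inverse PSL2one PSL2inv PSL2mul.
Proof. by move=> a; rewrite -[a]reprK PSL2inv_pi PSL2mul_pi SL2mulrV. Qed.

HB.instance Definition _ :=
  isGroup.Build PSL2 PSL2mulA PSL2mul1 PSL2mulr1 PSL2mulV PSL2mulrV.

(* Both traces are independent of the chosen lifts, see [tr2_pi], [trcomm_pi]. *)
Definition tr2 (f : PSL2) : R[i] := (\tr (repr f)) ^+ 2.
Definition trcomm (f g : PSL2) : R[i] :=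
  let A := repr f in let B := repr g in \tr (SL2val (A * B * A^-1 * B^-1)%g).

Lemma tr2_pi A : tr2 (\pi_PSL2 A) = (\tr A) ^+ 2.
Proof.
by rewrite /tr2; case: (repr_PSL2 A) => -> //=; rewrite raddfN sqrrN.
Qed.

Lemma trcomm_pi A B :
  trcomm (\pi_PSL2 A) (\pi_PSL2 B) = \tr (SL2val (A * B * A^-1 * B^-1)%g).
Proof.
have mE (B1 B2 : SL2) : (B1 * B2)%g = SL2mul B1 B2 by [].
have vE (B1 : SL2) : (B1^-1)%g = SL2inv B1 by [].
rewrite /trcomm; cbv zeta; rewrite !(mE, vE).
by case: (repr_PSL2 A) => ->; case: (repr_PSL2 B) => ->;
  rewrite ?SL2invN ?(SL2mulNl, SL2mulNr) ?SL2oppK.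
Qed.

End SL2.

(* R[i] is only partially ordered; Num.real holds exactly on the real axis. *)
Definition RP (R : realType) : set (set (PSL2 R)) :=
  [set G | exists f g : PSL2 R, [/\ G = gen [set f; g],
     tr2 f - 4 \is Num.real, tr2 g - 4 \is Num.real
   & trcomm f g - 2 \is Num.real]].

Section Adjugate2.
Variable F : numFieldType.
Implicit Types A X N : 'M[F]_2.

Lemma adj2 A : \adj A = (\tr A)%:M - A.
Proof.
have dm (B : 'M[F]_1) : \det B = B ord0 ord0.
  by rewrite (mx11_scalar B) det_scalar1 !mxE.
have lift01 : lift (0 : 'I_2) 0 = 1 by apply: val_inj.
have lift10 : lift (1 : 'I_2) 0 = 0 by apply: val_inj.
apply/matrixP => i j; rewrite !mxE /cofactor dm !mxE /mxtrace.
rewrite !big_ord_recl big_ord0.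
have cs (k : 'I_2) : k = 0 \/ k = 1.
  by case: k => [[|[|//]] ?]; [left | right]; apply: val_inj.
case: (cs i) => ->; case: (cs j) => -> /=; rewrite ?lift01 ?lift10.
all: rewrite ?(expr0, expr1, expr2, mul1r, mulNr, opprK, mulr1n, mulr0n, sub0r, addr0) //.
- by rewrite addrC addKr.
- by rewrite ?mul1r addrK.
Qed.

Lemma mulmx_adj2 X N : \det N = -1 ->
  N *m \adj X *m N = X + \tr (X *m \adj N) *: N.
Proof.
move=> dN.
have sym : X *m \adj N + N *m \adj X = (\tr (X *m \adj N))%:M.
  have trC : \tr (N *m \adj X) = \tr (X *m \adj N).
    by rewrite !adj2 !mulmxBr !mul_mx_scalar !raddfB /= !linearZ /= mulrC
      [\tr (X *m N)]mxtrace_mulC.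
  have adjD : \adj (X + N) = \adj X + \adj N.
    by rewrite !adj2 raddfD raddfD /= opprD addrACA.
  have E : X *m \adj N + N *m \adj X = (\det (X + N) - \det X - \det N)%:M.
    have := mul_mx_adj (X + N).
    rewrite adjD mulmxDl !mulmxDr !mul_mx_adj !raddfB /= => <-.
    have ab (V : zmodType) (a b c d : V) : b + c = a + b + (c + d) - a - d.
      by rewrite addrA [_ - a - d]addrAC addrK -(addrA a) addrC addKr.
    exact: ab.
  have := congr1 mxtrace E; rewrite raddfD /= trC mxtrace_scalar -mulr2n.
  set t := \tr _; set d := (_ - _ : F) => td; rewrite E; congr (_%:M).
  have two0 : (2 : F) != 0 by rewrite pnatr_eq0.
  by apply: (mulIf two0); rewrite !mulr_natr -td.
have -> : N *m \adj X = (\tr (X *m \adj N))%:M - X *m \adj N.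
  by rewrite -sym addrC addKr.
rewrite mulmxBl mul_scalar_mx -mulmxA mul_adj_mx dN mul_mx_scalar scaleN1r.
by rewrite opprK addrC.
Qed.

End Adjugate2.

(* Hyperbolic space as a sheet of the hyperboloid in the Minkowski space of    *)
(* Hermitian 2 x 2 matrices with quadratic form X |-> - \det X, of signature   *)
(* (3,1). PSL(2,C) acts by X |-> A X A^*, which identifies it with the group   *)
(* of orientation preserving isometries.                                       *)
Section Hyperbolic.
Variable R : realType.
Implicit Types X Y N U V : 'M[R[i]]_2.

(* The polarization of X |-> - \det X, see [mink_diag]. *)
Definition mink X Y : R[i] := - (\tr (X *m \adj Y) / 2).

Lemma mink_diag X : mink X X = - \det X.
Proof.
by rewrite /mink mul_mx_adj mxtrace_scalar -(mulr_natr (\det X)) mulfK// pnatr_eq0.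
Qed.

Definition posdef X : Prop :=
  forall v : 'rV[R[i]]_2, v != 0 -> 0 < (v *m X *m v ^t*) 0 0.

Record hyp3 := MkHyp3 { hyp3val :> 'M[R[i]]_2;
  _ : [&& hyp3val \is hermsymmx, \det hyp3val == 1 & `[< posdef hyp3val >]] }.
HB.instance Definition _ := [isSub for hyp3val].

(* Unit spacelike vectors: N is the unit normal of the plane {X | <N, X> = 0}, *)
(* pointing to the side <N, X> > 0.                                            *)
Record dS3 := MkDS3 { dS3val :> 'M[R[i]]_2;
  _ : (dS3val \is hermsymmx) && (mink dS3val dS3val == 1) }.
HB.instance Definition _ := [isSub for dS3val].

Lemma hermP X : reflect (X ^t* = X) (X \is hermsymmx).
Proof.
by rewrite is_hermitianmxE expr0 scale1r eq_sym; exact: eqP.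
Qed.

Lemma trC_mul m n p (A : 'M[R[i]]_(m, n)) (B : 'M[R[i]]_(n, p)) :
  (A *m B) ^t* = B ^t* *m A ^t*.
Proof. by rewrite trmx_mul map_mxM. Qed.

Lemma det_trC n (A : 'M[R[i]]_n) : \det (A ^t*) = (\det A)^*.
Proof. by rewrite det_map_mx det_tr. Qed.

Lemma congr_subproof (B : 'M[R[i]]_2) (X : hyp3) : `|\det B| = 1 ->
  let Y := B *m X *m B ^t* in
  [&& Y \is hermsymmx, \det Y == 1 & `[< posdef Y >]].
Proof.
case: X => X /= /and3P[/hermP hX /eqP dX /asboolP pX] dB; apply/and3P; split.
- by apply/hermP; rewrite !trC_mul trmxCK hX mulmxA.
- by rewrite !det_mulmx det_trC dX mulr1 -normCK dB expr1n.
- apply/asboolP => v v0; rewrite !mulmxA -[_ *m _ *m v ^t*]mulmxA -trC_mul.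
  apply: pX; apply: contra_neq v0 => vB0.
  have uB : B \in unitmx by rewrite unitmxE unitfE -normr_eq0 dB oner_eq0.
  by rewrite -[v](mulmxK uB) vB0 mul0mx.
Qed.

Lemma norm_det_SL2 (A : SL2 R) : `|\det A| = 1.
Proof. by rewrite det_SL2 normr1. Qed.

Definition SL2act (A : SL2 R) (X : hyp3) : hyp3 :=
  MkHyp3 (congr_subproof X (norm_det_SL2 A)).

Definition act (a : PSL2 R) : hyp3 -> hyp3 := SL2act (repr a).

Lemma act_pi (A : SL2 R) : act (\pi_(PSL2 R) A) = SL2act A.
Proof.
apply: funext => X; apply: val_inj; rewrite /act.
case: (repr_PSL2 A) => -> //=.
by rewrite linearN/= map_mxN mulNmx mulmxN mulNmx opprK.
Qed.

Lemma refl_mx X N : \det N = -1 ->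
  X - (2 * mink X N) *: N = N *m \adj X *m N.
Proof.
move=> dN; rewrite mulmx_adj2// /mink mulrN mulrC divfK ?pnatr_eq0//.
by rewrite scaleNr opprK.
Qed.

Lemma reflection_subproof (N : dS3) (X : hyp3) :
  let Y := hyp3val X - (2 * mink X N) *: dS3val N in
  [&& Y \is hermsymmx, \det Y == 1 & `[< posdef Y >]].
Proof.
case: N => N /= /andP[/hermP hN /eqP]; rewrite mink_diag => /eqP.
rewrite eqr_oppLR => /eqP dN.
have [/hermP hX dX] : hyp3val X \is hermsymmx /\ \det X = 1.
  by case: X => X /= /and3P[? /eqP ?].
have hA : (\adj X) ^t* = \adj X by rewrite trmx_adj map_mx_adj hX.
have dA : \det (\adj X) = 1.
  by have := congr1 determinant (mul_mx_adj X); rewrite det_mulmx dX mul1r det1.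
have -> : hyp3val X - (2 * mink X N) *: N =
    (N *m \adj X) *m X *m (N *m \adj X) ^t*.
  rewrite refl_mx// trC_mul hN hA -[_ *m \adj X *m X]mulmxA mul_adj_mx dX.
  by rewrite mulmx1 !mulmxA.
by apply: congr_subproof; rewrite det_mulmx dN dA mulr1 normrN1.
Qed.

Definition reflection (N : dS3) (X : hyp3) : hyp3 :=
  MkHyp3 (reflection_subproof N X).

(* U and V are meant to be orthonormal; [axis U V] is then a geodesic line, the *)
(* intersection of two orthogonal planes, and [rotation U V t] rotates by the   *)
(* angle t about it.                                                            *)
Definition axis (U V : dS3) : set hyp3 :=
  [set X : hyp3 | mink X U = 0 /\ mink X V = 0].

Definition rotation (U V : dS3) (t : R) X : 'M[R[i]]_2 :=
  let a := mink X U in let b := mink X V in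
  let c := (cos t)%:C%C in let s := (sin t)%:C%C in
  X - a *: dS3val U - b *: dS3val V
    + (a * c - b * s) *: dS3val U + (a * s + b * c) *: dS3val V.

Definition half_turn (l : set hyp3) (e : PSL2 R) : Prop :=
  exists U V : dS3, [/\ mink U V = 0, l = axis U V
    & forall X : hyp3, hyp3val (act e X) = rotation U V pi X].

(* The component of X orthogonal to P, a tangent vector at P pointing along the *)
(* geodesic from P to X (zero if X = P).                                        *)
Definition direction (P X : hyp3) : 'M[R[i]]_2 :=
  hyp3val X + mink X P *: hyp3val P.

Definition orthogonal_lines (l m : set hyp3) : Prop :=
  exists P : hyp3, [/\ l P, m P
    & forall X Y : hyp3, l X -> m Y -> mink (direction P X) (direction P Y) = 0].

(* The vertices lie in hyp3 and determine the outward unit normals of the faces *)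
(* opposite to them; [body T] is the convex hull of the vertices, hence compact *)
(* and nondegenerate.                                                           *)
Record tetrahedron := Tetrahedron {
  vertex : 'I_4 -> hyp3;
  normal : 'I_4 -> dS3;
  mink_normal_vertex : forall i j, i != j -> mink (normal i) (vertex j) = 0;
  mink_normal_opp : forall i, mink (normal i) (vertex i) < 0
}.

Definition body (T : tetrahedron) : set hyp3 :=
  [set X | forall i, mink (normal T i) X <= 0].

Definition face (T : tetrahedron) (i : 'I_4) : set hyp3 :=
  body T `&` [set X : hyp3 | mink (normal T i) X = 0].

Definition edge (T : tetrahedron) (i j : 'I_4) : set hyp3 :=
  face T i `&` face T j.

(* The interior angle is pi minus the angle between the outward normals.        *)
Definition dihedral_angle (T : tetrahedron) (i j : 'I_4) (t : R) : Prop :=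
  0 <= t <= pi /\ mink (normal T i) (normal T j) = - (cos t)%:C%C.

(* F_1, F_2, F_3, F_4 are the faces of indices 0, 1, 2, 3.                      *)
Definition coxeter353 (T : tetrahedron) : Prop :=
  [/\ dihedral_angle T 0 1 (pi / 3), dihedral_angle T 1 2 (pi / 5)
    & dihedral_angle T 2 3 (pi / 3)] /\
  [/\ dihedral_angle T 0 2 (pi / 2), dihedral_angle T 0 3 (pi / 2)
    & dihedral_angle T 1 3 (pi / 2)].

(* Reflections being involutions, inverses need not be added.                   *)
Inductive reflection_group (T : tetrahedron) : set (hyp3 -> hyp3) :=
| reflection_group1 : reflection_group T id
| reflection_groupM i g : reflection_group T g ->
    reflection_group T (reflection (normal T i) \o g).

(* The orientation preserving elements of the reflection group, that is, those  *)
(* that come from PSL(2,C).                                                     *)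
Definition Delta (T : tetrahedron) : set (PSL2 R) :=
  [set a | reflection_group T (act a)].

Definition Gamma (T : tetrahedron) (e : PSL2 R) : set (PSL2 R) :=
  gen (Delta T `|` [set e]).

End Hyperbolic.

(* Main.v *)
Require Import Defs.
From mathcomp Require Import all_boot all_order all_algebra ring.
From mathcomp Require Import complex boolp classical_sets reals trigo.

Import Order.TTheory GRing.Theory Num.Theory.
Local Open Scope quotient_scope.
Local Open Scope sesquilinear_scope.
Local Open Scope ring_scope.

Set Implicit Arguments.
Unset Strict Implicit.
Unset Printing Implicit Defensive.

(** Write r_0, ..., r_3 for the reflections in the faces, so that Delta is
    generated by a = r_0 r_1, f = r_1 r_2 and r_2 r_3. The half-turn e exchanges
    the faces F_1, F_4 and the faces F_2, F_3, hence e r_i e = r_(3-i). Put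
    g = a e f^2. Then

    - f g f^-1 g^-1 = a ([commutator_fg]), so the subgroup generated by f and g
      contains a, then e = a^-1 g f^-2, and then r_2 r_3 = e a^-1 e; it is all of
      Gamma ([Gamma_gen]);
    - f and the commutator a are products of two reflections, and such a product
      lifts to N \adj M in SL(2,C), whose trace is minus twice the inner product
      of the normals, a real number ([real_trace]);
    - s = r_1 r_2 r_1 r_2 r_1 = r_2 r_1 r_2 r_1 r_2 is a reflection that commutes
      with e, because the angle between F_2 and F_3 is pi / 5, and g = r_0 e s.
      So g^2 = r_0 (s r_3 s) is again a product of two reflections ([sqr_g]), and
      tr^2 g = tr (g^2) + 2 is real.

    Words in the reflections are compared as maps of hyperbolic space, which is
    enough because PSL(2,C) acts faithfully ([act_inj]) and contains no
    reflection ([act_neq_reflection]).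

    That e exchanges the faces is the geometric part. Let P and Q be the points
    where the axis meets the two edges, and k = <P, Q>. The tangent Q + k P of the
    axis at P is orthogonal to the edge, hence a combination of the normals of the
    two faces through it ([foot_on_edge]), and similarly at Q. Pairing these two
    equations with the four normals gives a linear system that forces both
    combinations to be symmetric ([feet_symmetric]), which says that n_0 + n_3 and
    n_1 + n_2 span the plane of the axis while n_0 - n_3 and n_1 - n_2 are
    orthogonal to it; the half-turn fixes the former and negates the latter
    ([half_turn_swap]). *)

(** * The Minkowski form and reflections *)

Lemma ord2P (P : 'I_2 -> Prop) : P 0 -> P 1 -> forall i, P i.
Proof.
by move=> P0 P1 [[|[|//]] hi];
  [rewrite (_ : Ordinal hi = 0) | rewrite (_ : Ordinal hi = 1)];
  rewrite //; apply: val_inj.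
Qed.

Lemma mx2P (A : Type) (M N : 'M[A]_2) :
  M 0 0 = N 0 0 -> M 0 1 = N 0 1 -> M 1 0 = N 1 0 -> M 1 1 = N 1 1 -> M = N.
Proof.
move=> *; apply/matrixP => i j.
by elim/ord2P: i; elim/ord2P: j.
Qed.

Lemma adj2E (F : comNzRingType) (A : 'M[F]_2) :
  [/\ (\adj A) 0 0 = A 1 1, (\adj A) 0 1 = - A 0 1,
      (\adj A) 1 0 = - A 1 0 & (\adj A) 1 1 = A 0 0].
Proof.
have lift01 : lift (0 : 'I_2) 0 = 1 by apply: val_inj.
have lift10 : lift (1 : 'I_2) 0 = 0 by apply: val_inj.
by split; rewrite mxE /cofactor det_mx11 !mxE ?lift01 ?lift10 /= ?expr1 ?expr0
  ?expr2; ring.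
Qed.

Lemma sum2E (F : nmodType) (f : 'I_2 -> F) : \sum_i f i = f 0 + f 1.
Proof. by rewrite !big_ord_recl big_ord0 addr0; congr (_ + f _); apply: val_inj. Qed.

Lemma mulmx2E (F : pzSemiRingType) m n (A : 'M[F]_(m, 2)) (B : 'M[F]_(2, n)) i j :
  (A *m B) i j = A i 0 * B 0 j + A i 1 * B 1 j.
Proof. by rewrite mxE sum2E. Qed.

(* ring compares its atoms up to conversion, which would unfold mink: the values
   of the form are generalized first. *)
Ltac mink_ring :=
  repeat match goal with |- context [mink ?X ?Y] => move: (mink X Y) => ? end;
  ring.

Section Minkowski.
Variable R : realType.
Local Notation C := R[i].
Implicit Types X Y Z N M U V : 'M[C]_2.

Lemma minkE X Y : mink X Y =
  (X 0 1 * Y 1 0 + X 1 0 * Y 0 1 - X 0 0 * Y 1 1 - X 1 1 * Y 0 0) / 2.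
Proof.
have [a00 a01 a10 a11] := adj2E Y.
by rewrite /mink /mxtrace sum2E !mulmx2E a00 a01 a10 a11; field.
Qed.

Lemma minkC X Y : mink X Y = mink Y X.
Proof. by rewrite !minkE; ring. Qed.
Lemma minkDl X Y Z : mink (X + Y) Z = mink X Z + mink Y Z.
Proof. by rewrite !minkE !mxE; ring. Qed.
Lemma minkZl a X Z : mink (a *: X) Z = a * mink X Z.
Proof. by rewrite !minkE !mxE; ring. Qed.
Lemma minkNl X Z : mink (- X) Z = - mink X Z.
Proof. by rewrite !minkE !mxE; ring. Qed.
Lemma minkDr Z X Y : mink Z (X + Y) = mink Z X + mink Z Y.
Proof. by rewrite !(minkC Z) minkDl. Qed.
Lemma minkZr a Z X : mink Z (a *: X) = a * mink Z X.
Proof. by rewrite !(minkC Z) minkZl. Qed.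
Lemma minkNr Z X : mink Z (- X) = - mink Z X.
Proof. by rewrite !(minkC Z) minkNl. Qed.

Definition mink_lin := (minkDl, minkDr, minkZl, minkZr, minkNl, minkNr).

Definition refl N X : 'M[C]_2 := X - (2 * mink X N) *: N.

Lemma refl_mink N X Y : mink N N = 1 -> mink (refl N X) (refl N Y) = mink X Y.
Proof. by move=> hN; rewrite /refl !mink_lin hN (minkC N Y); mink_ring. Qed.

Lemma reflK N : mink N N = 1 -> involutive (refl N).
Proof.
move=> hN X; rewrite /refl !mink_lin hN.
by apply/matrixP => i j; rewrite !mxE; mink_ring.
Qed.

(** Every relation between reflections is drawn from this one: reflecting the
    normal of a mirror conjugates the reflection. *)
Lemma refl_conj M N X : mink M M = 1 ->
  refl (refl M N) X = refl M (refl N (refl M X)).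
Proof.
move=> hM; rewrite /refl !mink_lin hM (minkC N M).
by apply/matrixP => i j; rewrite !mxE; mink_ring.
Qed.

Lemma herm_mink_real X Y : X \is hermsymmx -> Y \is hermsymmx ->
  mink X Y \is Num.real.
Proof.
move=> /hermP hX /hermP hY.
have eX i j : X i j = (X j i)^* by rewrite -{1}hX !mxE.
have eY i j : Y i j = (Y j i)^* by rewrite -{1}hY !mxE.
rewrite CrealE minkE; apply/eqP.
rewrite rmorphM fmorphV rmorph_nat !(rmorphM, rmorphD, rmorphN) /= -!eX -!eY.
by ring.
Qed.

Lemma hermD X Y : X \is hermsymmx -> Y \is hermsymmx -> X + Y \is hermsymmx.
Proof. by move=> /hermP hX /hermP hY; apply/hermP; rewrite raddfD map_mxD hX hY. Qed.

Lemma hermZ (a : C) X : a \is Num.real -> X \is hermsymmx -> a *: X \is hermsymmx.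
Proof.
move=> ha /hermP hX; apply/hermP.
by rewrite linearZ/= map_mxZ hX; congr (_ *: _); exact/CrealP.
Qed.

End Minkowski.

Section Frames.
Variable R : realType.
Local Notation C := R[i].
Implicit Types X Y A B D E : 'M[C]_2.

Lemma mink0l X : mink 0 X = 0 :> C.
Proof. by rewrite minkE !mxE; ring. Qed.

(** Four pairwise orthogonal non-isotropic vectors span the space of 2 x 2
    matrices, so that nothing is orthogonal to all of them. *)
Lemma orthogonal_frame A B D E X :
  [/\ mink A A != 0, mink B B != 0, mink D D != 0 & mink E E != 0] ->
  [/\ mink A B = 0, mink A D = 0 & mink A E = 0] ->
  [/\ mink B D = 0, mink B E = 0 & mink D E = 0] ->
  [/\ mink X A = 0, mink X B = 0, mink X D = 0 & mink X E = 0] -> X = 0.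
Proof.
move=> [A0 B0 D0 E0] [AB AD AE] [BD BE DE] [XA XB XD XE].
have lin_indep a b d e Y : a *: A + (b *: B + (d *: D + (e *: E + 0))) = Y ->
    [/\ mink Y A = 0, mink Y B = 0, mink Y D = 0 & mink Y E = 0] ->
    [/\ a = 0, b = 0, d = 0 & e = 0].
  move=> <- []; rewrite addr0 !mink_lin (minkC B A) (minkC D A) (minkC E A).
  rewrite (minkC D B) (minkC E B) (minkC E D) AB AD AE BD BE DE.
  move: (mink A A) (mink B B) (mink D D) (mink E E) A0 B0 D0 E0 => p q r s.
  move=> p0 q0 r0 s0; rewrite !mulr0 !addr0 !add0r => /eqP + /eqP + /eqP + /eqP.
  rewrite !mulf_eq0 (negPf p0) (negPf q0) (negPf r0) (negPf s0) !orbF.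
  by do 4![move=> /eqP ->].
pose v := [tuple A; B; D; E].
have sumv (k : 'I_4 -> C) : \sum_(i < 4) k i *: v`_i =
    k 0 *: A + (k 1 *: B + (k 2%:R *: D + (k 3%:R *: E + 0))).
  rewrite !big_ord_recl big_ord0 /=.
  by do ![congr (_ + _)]; congr (k _ *: _); apply: val_inj.
have fv : free v.
  apply/freeP => k; rewrite sumv => /lin_indep[]; rewrite ?mink0l// => k0 k1 k2 k3.
  case=> [[|[|[|[|//]]]] hi]; [move: k0 | move: k1 | move: k2 | move: k3];
    by move=> <-; congr k; apply: val_inj.
have bv : basis_of fullv v.
  by rewrite basisEfree fv subvf size_tuple dimvf /dim /= muln2.
have := coord_basis bv (memvf X); rewrite sumv => /esym/lin_indep[]//.
move=> c0 c1 c2 c3; rewrite (coord_basis bv (memvf X)) sumv c0 c1 c2 c3.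
by rewrite !scale0r !addr0.
Qed.
End Frames.

Section HyperbolicPoints.
Variable R : realType.
Local Notation C := R[i].
Implicit Types (P Q : hyp3 R) (N : dS3 R).

Lemma hyp3_herm P : hyp3val P \is hermsymmx.
Proof. by case: P => P /= /and3P[]. Qed.

Lemma hyp3_det P : \det (hyp3val P) = 1.
Proof. by case: P => P /= /and3P[_ /eqP]. Qed.

Lemma hyp3_mink P : mink P P = -1.
Proof. by rewrite mink_diag hyp3_det. Qed.

Lemma dS3_herm N : dS3val N \is hermsymmx.
Proof. by case: N => N /= /andP[]. Qed.

Lemma dS3_mink N : mink N N = 1.
Proof. by case: N => N /= /andP[_ /eqP]. Qed.

Lemma dS3_det N : \det (dS3val N) = -1.
Proof. by apply/eqP; rewrite -eqr_oppLR -mink_diag dS3_mink. Qed.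

Lemma hyp3_gt0 P : 0 < hyp3val P 0 0.
Proof.
case: P => P /= /and3P[_ _ /asboolP pP].
have := pP (\row_j if j == 0 then 1 else 0).
rewrite !mulmx2E !mxE /= conjC0 conjC1 !mulr0 !mul0r !mulr1 !mul1r !addr0; apply.
by apply/eqP => /matrixP/(_ 0 0); rewrite !mxE /= => /eqP; rewrite oner_eq0.
Qed.

(** The form is positive definite on the tangent space at [P]: completing the
    square gives p^2 <D, D> = |p b - a q|^2 + a^2 for the entries p, q of [P]
    and a, b of [D]. *)
Lemma tangent_definite P (D : 'M[C]_2) : D \is hermsymmx -> mink D P = 0 ->
  0 <= mink D D /\ (mink D D = 0 -> D = 0).
Proof.
move=> /hermP hD DP0; have /hermP hP := hyp3_herm P.
have p0 := hyp3_gt0 P; have dP := hyp3_mink P.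
have eP : hyp3val P 1 0 = (hyp3val P 0 1)^* by rewrite -{1}hP !mxE.
have eD : D 1 0 = (D 0 1)^* by rewrite -{1}hD !mxE.
have ea : (D 0 0)^* = D 0 0 by rewrite -{2}hD !mxE.
have ep : (hyp3val P 0 0)^* = hyp3val P 0 0 by apply/CrealP/gtr0_real.
have sq : hyp3val P 0 0 ^+ 2 * mink D D =
    `|hyp3val P 0 0 * D 0 1 - D 0 0 * hyp3val P 0 1| ^+ 2 + `|D 0 0| ^+ 2.
  rewrite !normCK rmorphB !rmorphM /= ea ep.
  move: DP0 dP; rewrite !minkE eP eD.
  move: (hyp3val P 0 0) (hyp3val P 0 1) ((hyp3val P 0 1)^*) (hyp3val P 1 1)
    (D 0 0) (D 0 1) ((D 0 1)^*) (D 1 1) => p q q' r a b b' c DP0 dP.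
  have {}DP0 : b * q' + b' * q = a * r + c * p.
    by apply/eqP; rewrite -subr_eq0 -[_ - _](mulfK (_ : 2 != 0)) ?pnatr_eq0//;
      rewrite -[X in _ == X](mul0r 2) -DP0; apply/eqP; field.
  have {}dP : p * r - q * q' = 1 by apply: oppr_inj; rewrite -dP; field.
  have -> : (p * b - a * q) * (p * b' - a * q') + a * a =
    p ^+ 2 * (b * b') - a * p * (b * q' + b' * q) + a ^+ 2 * (q * q' + 1) by ring.
  have -> : q * q' + 1 = p * r by rewrite -dP; ring.
  by rewrite DP0; field.
have pp : 0 < hyp3val P 0 0 ^+ 2 by rewrite exprn_gt0.
split; first by rewrite -(pmulr_rge0 _ pp) sq addr_ge0// exprn_ge0.
move=> DD0; move: sq; rewrite DD0 mulr0 => /esym/eqP.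
rewrite paddr_eq0 ?exprn_ge0// !expf_eq0 !normr_eq0 /= => /andP[+ /eqP a0].
rewrite a0 mul0r subr0 mulf_eq0 (gt_eqF p0) /= => /eqP b0.
have b'0 : D 1 0 = 0 by rewrite eD b0 conjC0.
apply/mx2P; rewrite !mxE//; move: DP0; rewrite minkE a0 b0 b'0 !mul0r.
move/eqP; rewrite mulf_eq0 invr_eq0 pnatr_eq0 orbF addr0 subr0 sub0r oppr_eq0.
by rewrite mulf_eq0 (gt_eqF p0) orbF => /eqP.
Qed.

End HyperbolicPoints.

(** * Isometries and their lifts *)

Lemma adjM2 (F : comNzRingType) (A B : 'M[F]_2) :
  \adj (A *m B) = \adj B *m \adj A.
Proof.
have [b00 b01 b10 b11] := adj2E B; have [a00 a01 a10 a11] := adj2E A.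
have [c00 c01 c10 c11] := adj2E (A *m B).
by apply/mx2P; rewrite ?c00 ?c01 ?c10 ?c11 !mulmx2E ?a00 ?a01 ?a10 ?a11
  ?b00 ?b01 ?b10 ?b11; ring.
Qed.

Lemma adj2K (F : comNzRingType) (A : 'M[F]_2) : \adj (\adj A) = A.
Proof.
have [b00 b01 b10 b11] := adj2E (\adj A); have [a00 a01 a10 a11] := adj2E A.
by apply/mx2P; rewrite ?b00 ?b01 ?b10 ?b11 ?a00 ?a01 ?a10 ?a11 ?opprK.
Qed.

Lemma det2E (F : comNzRingType) (A : 'M[F]_2) :
  \det A = A 0 0 * A 1 1 - A 0 1 * A 1 0.
Proof.
have [a00 a01 a10 a11] := adj2E A.
have /matrixP/(_ 0 0) := mul_mx_adj A.
by rewrite mulmx2E a00 a10 !mxE eqxx mulr1n => <-; ring.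
Qed.

Section Isometries.
Variable R : realType.
Local Notation C := R[i].
Implicit Types (X : hyp3 R) (N M : dS3 R) (a b : PSL2 R) (A B : SL2 R).

Lemma pi_mulg A B : \pi_(PSL2 R) (SL2mul A B) = (\pi_(PSL2 R) A * \pi_(PSL2 R) B)%g.
Proof. by rewrite -PSL2mul_pi. Qed.

Lemma pi_invg A : \pi_(PSL2 R) (SL2inv A) = ((\pi_(PSL2 R) A)^-1)%g.
Proof. by rewrite -PSL2inv_pi. Qed.

Lemma act1 X : act 1%g X = X.
Proof.
rewrite [1%g](_ : _ = \pi_(PSL2 R) (SL2one R))// act_pi; apply: val_inj => /=.
by rewrite mul1mx trmx1 map_mx1 mulmx1.
Qed.

Lemma actM a b X : act (a * b)%g X = act a (act b X).
Proof.
rewrite -[a]reprK -[b]reprK -pi_mulg !act_pi; apply: val_inj => /=.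
by rewrite trC_mul !mulmxA.
Qed.

Lemma actVK a X : act (a^-1)%g (act a X) = X.
Proof. by rewrite -actM mulVg act1. Qed.

Lemma actKV a X : act a (act (a^-1)%g X) = X.
Proof. by rewrite -actM mulgV act1. Qed.

Lemma origin_subproof : [&& (1%:M : 'M[C]_2) \is hermsymmx,
  \det (1%:M : 'M[C]_2) == 1 & `[< posdef (1%:M : 'M[C]_2) >]].
Proof.
apply/and3P; split; first by apply/hermP; rewrite trmx1 map_mx1.
  by rewrite det1.
apply/asboolP => v v0; rewrite mulmx1 mulmx2E !mxE -!normCK.
rewrite lt_def paddr_eq0 ?exprn_ge0// addr_ge0 ?exprn_ge0// andbT.
apply: contra_neqN v0 => /andP[]; rewrite !expf_eq0 !normr_eq0 /=.
by move=> /eqP h0 /eqP h1; apply/rowP; apply: ord2P; rewrite mxE.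
Qed.

Definition origin := MkHyp3 origin_subproof.

Lemma shear_subproof (z : C) :
  \det (\matrix_(i, j) (if i == j then 1 else if i == 0 then z else 0) : 'M[C]_2) == 1.
Proof. by rewrite det2E !mxE /= mulr0 subr0 mulr1. Qed.

Definition shear z := MkSL2 (shear_subproof z).

Lemma sheared_origin z : exists X : hyp3 R,
  [/\ hyp3val X 0 0 = 1 + z * z^*, hyp3val X 0 1 = z,
      hyp3val X 1 0 = z^* & hyp3val X 1 1 = 1].
Proof.
exists (SL2act (shear z) origin).
by split; rewrite /= mulmx1 mulmx2E !mxE /= ?conjC0 ?conjC1
  ?(mulr0, mulr1, mul0r, mul1r, addr0, add0r).
Qed.

(** The translates of the origin by shears suffice to see that a matrix acting
    trivially is scalar. *)
Lemma SL2act_id A : (forall X, SL2act A X = X) ->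
  A = SL2one R \/ A = SL2opp (SL2one R).
Proof.
move=> hA; have mA X : val A *m X *m (val A) ^t* = hyp3val X.
  by rewrite -{2}(hA X).
have /mulmx1C uA : val A *m (val A) ^t* = 1%:M.
  by have := mA origin; rewrite /= mulmx1.
have cA X : val A *m X = hyp3val X *m val A.
  by rewrite -[in RHS](mA X) -!mulmxA uA mulmx1.
have A00 z : val A 0 1 * z^* = z * val A 1 0.
  have [X [x00 x01 x10 x11]] := sheared_origin z.
  have /matrixP/(_ 0 0) := cA X.
  rewrite !mulmx2E x00 x01 x10 => h; apply: (addrI (val A 0 0 * (1 + z * z^*))).
  by rewrite h; ring.
have A01 : val A 0 1 = 0 /\ val A 1 0 = 0.
  have h1 := A00 1; have hi := A00 'i; rewrite conjC1 mulr1 mul1r in h1.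
  rewrite conjCi h1 mulrN mulrC in hi.
  have : 2 * ('i * val A 1 0) = 0 by rewrite mulr_natl mulr2n -{1}hi addNr.
  move/eqP; rewrite mulf_eq0 pnatr_eq0 mulf_eq0 (negPf (neq0Ci _)) /= => /eqP h0.
  by rewrite h1 h0.
case: A01 => A01 A10.
have A11 : val A 1 1 = val A 0 0.
  have [X [x00 x01 x10 x11]] := sheared_origin 1.
  have /matrixP/(_ 0 1) := cA X.
  by rewrite !mulmx2E x00 x01 x11 A01 mul0r mulr0 addr0 mulr1 mul1r add0r => ->.
have : val A 0 0 ^+ 2 == 1.
  by have := det_SL2 A; rewrite det2E A01 mul0r subr0 A11 -expr2 => ->.
rewrite sqrf_eq1 => /orP[]/eqP a1; [left|right]; apply: val_inj => /=;
  by apply/mx2P; rewrite !mxE /= ?A11 ?A01 ?A10 ?a1 ?mulr1n ?mulr0n ?oppr0.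
Qed.

Lemma act_inj a b : (forall X, act a X = act b X) -> a = b.
Proof.
move=> hab; suff h : (b^-1 * a)%g = 1%g by rewrite -[a](mulVKg b) h mulg1.
have : forall X, act (b^-1 * a)%g X = X by move=> X; rewrite actM hab actVK.
set c := (b^-1 * a)%g; rewrite -[c]reprK => hc.
rewrite [1%g](_ : _ = \pi_(PSL2 R) (SL2one R))//.
by apply/eqP/PSL2_eqP/SL2act_id => X; rewrite -act_pi.
Qed.

Lemma reflection_mx N X : hyp3val (reflection N X) = dS3val N *m \adj X *m N.
Proof. exact: refl_mx (dS3_det N). Qed.

(** Orientation: a product of an odd number of reflections does not lift to
    PSL(2,C). If it did, some D would satisfy D X D^* = \adj X for all X, and
    the translates of the origin by shears would force D = 0. *)
Lemma act_neq_reflection a N : ~ (forall X, act a X = reflection N X).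
Proof.
rewrite -[a]reprK act_pi; move: (repr a) => A hA.
pose D := \adj (dS3val N) *m val A.
have hN : (dS3val N) ^t* = N by apply/hermP/dS3_herm.
have hD X : D *m X *m D ^t* = \adj X.
  have hadj : (\adj (dS3val N)) ^t* = \adj N by rewrite trmx_adj map_mx_adj hN.
  rewrite /D trC_mul hadj.
  have -> : \adj N *m val A *m X *m ((val A) ^t* *m \adj N) =
    \adj N *m (hyp3val (SL2act A X)) *m \adj N by rewrite /= !mulmxA.
  rewrite hA reflection_mx !mulmxA mul_adj_mx dS3_det -!mulmxA mul_mx_adj dS3_det.
  by rewrite mul_scalar_mx mul_mx_scalar scalerA mulrNN mul1r scale1r.
move: D hD => D hD.
have a1 : \adj (1%:M : 'M[C]_2) = 1%:M.
  have [H H0 H1 H2] := adj2E (1%:M : 'M[C]_2).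
  by apply/mx2P; rewrite ?H ?H0 ?H1 ?H2; rewrite !mxE /=; rewrite ?mulr0n ?oppr0.
have /mulmx1C uD : D *m D ^t* = 1%:M.
  by have := hD origin; rewrite /= mulmx1 a1.
have cD X : D *m X = \adj (hyp3val X) *m D.
  by rewrite -[in RHS](hD X) -!mulmxA uD mulmx1.
have D00 z : D 0 0 * (z * z^*) + D 0 1 * z^* + z * D 1 0 = 0.
  have [X [x00 x01 x10 x11]] := sheared_origin z.
  have [y00 y01 y10 y11] := adj2E X; have /matrixP/(_ 0 0) := cD X.
  rewrite !mulmx2E y00 y01 x00 x01 x10 x11 => h.
  apply: (addrI (D 0 0 - z * D 1 0)); rewrite addr0.
  by transitivity (D 0 0 * (1 + z * z^*) + D 0 1 * z^*); [|rewrite h]; ring.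
have h1 := D00 1; have hm := D00 (-1); have hi := D00 'i.
rewrite rmorphN /= conjC1 in h1 hm; rewrite conjCi in hi.
have D00z : D 0 0 = 0.
  have : 2 * D 0 0 = 0 by rewrite -[RHS](addr0 0) -[in X in X + _]h1 -hm; ring.
  by move/eqP; rewrite mulf_eq0 pnatr_eq0 => /eqP.
have D01 : D 0 1 = - D 1 0.
  by apply/eqP; rewrite -addr_eq0; apply/eqP; rewrite -h1 D00z; ring.
have D10 : D 1 0 = 0.
  have : 2 * ('i * D 1 0) = 0 by rewrite -hi D00z D01; ring.
  by move/eqP; rewrite mulf_eq0 pnatr_eq0 mulf_eq0 (negPf (neq0Ci _)) => /eqP.
have [_] := mulmx1_unit uD.
by rewrite unitmxE det2E D00z D10 mul0r mulr0 subr0 unitr0.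
Qed.

End Isometries.

(** * Products of reflections *)

Section Reflections.
Variable R : realType.
Local Notation C := R[i].
Implicit Types (X : hyp3 R) (N M : dS3 R) (a b : PSL2 R) (A B : SL2 R).

Lemma refl_dS3_subproof N M :
  (refl N M \is hermsymmx) && (mink (refl N M) (refl N M) == 1 :> C).
Proof.
rewrite refl_mink ?dS3_mink// eqxx andbT /refl -scaleNr.
apply: hermD (dS3_herm M) _; apply: hermZ (dS3_herm N).
by rewrite realN realM ?realn// herm_mink_real ?dS3_herm.
Qed.

Definition refl_dS3 N M : dS3 R := MkDS3 (refl_dS3_subproof N M).

Lemma reflectionK N : involutive (reflection N).
Proof. by move=> X; apply: val_inj; exact: reflK (dS3_mink N) X. Qed.

Lemma reflection_conj N M X :
  reflection (refl_dS3 N M) X = reflection N (reflection M (reflection N X)).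
Proof. by apply: val_inj; exact: refl_conj (dS3_mink N). Qed.

Lemma reflection_commute N M X : mink N M = 0 ->
  reflection N (reflection M X) = reflection M (reflection N X).
Proof.
move=> NM; have NE : refl_dS3 M N = N.
  by apply: val_inj; rewrite /= /refl NM mulr0 scale0r subr0.
by rewrite -{1}NE reflection_conj reflectionK.
Qed.

Lemma refl_dS3_sum N M : mink N M = - (1 / 2) -> refl_dS3 N M = refl_dS3 M N.
Proof.
move=> NM; apply: val_inj; rewrite /= /refl (minkC M N) NM.
by apply/matrixP => i j; rewrite !mxE; field.
Qed.

Lemma reflection_braid3 N M X : mink N M = - (1 / 2) ->
  reflection N (reflection M (reflection N X)) =
  reflection M (reflection N (reflection M X)).
Proof.
by move=> NM; have := reflection_conj N M X; rewrite refl_dS3_sum// reflection_conj.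
Qed.

(** With c = cos (pi / 5), both sides are 2c (N + M), the normal of the mirror
    that exchanges the mirrors of [N] and [M]. *)
Lemma refl_dS3_pentagon N M (c : C) : mink N M = - c -> 4 * c ^+ 2 = 2 * c + 1 ->
  refl_dS3 N (refl_dS3 M N) = refl_dS3 M (refl_dS3 N M).
Proof.
move=> NM c2; apply: val_inj; rewrite /= /refl !mink_lin !dS3_mink (minkC M N) NM.
apply/matrixP => i j; rewrite !mxE; apply/eqP; rewrite -subr_eq0; apply/eqP.
transitivity ((4 * c ^+ 2 - (2 * c + 1)) * (dS3val N i j - dS3val M i j)); first by ring.
by rewrite c2 subrr mul0r.
Qed.

Lemma reflection_braid5 N M (c : C) X : mink N M = - c -> 4 * c ^+ 2 = 2 * c + 1 ->
  reflection N (reflection M (reflection N (reflection M (reflection N X)))) =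
  reflection M (reflection N (reflection M (reflection N (reflection M X)))).
Proof.
move=> NM c2; have := reflection_conj N (refl_dS3 M N) X.
by rewrite (refl_dS3_pentagon NM c2) !reflection_conj => ->.
Qed.

Lemma refl_pair_subproof N M : \det (dS3val N *m \adj (dS3val M)) == 1.
Proof.
have dM : \det (\adj (dS3val M)) = -1.
  have := congr1 determinant (mul_mx_adj (dS3val M)).
  rewrite det_mulmx det_scalar dS3_det sqrrN expr1n mulN1r => h.
  by rewrite -[LHS]opprK h.
by rewrite det_mulmx dM dS3_det mulrNN mulr1.
Qed.

(** The lift to SL(2,C) of the product of two reflections. *)
Definition refl_pair N M : PSL2 R := \pi_(PSL2 R) (MkSL2 (refl_pair_subproof N M)).

Lemma act_refl_pair N M X : act (refl_pair N M) X = reflection N (reflection M X).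
Proof.
have hN : (dS3val N) ^t* = N by apply/hermP/dS3_herm.
have hM : (\adj (dS3val M)) ^t* = \adj M.
  by rewrite trmx_adj map_mx_adj; congr (\adj _); apply/hermP/dS3_herm.
apply: val_inj; rewrite -[RHS]/(hyp3val (reflection N (reflection M X))).
rewrite reflection_mx reflection_mx !adjM2 adj2K /refl_pair act_pi /=.
by rewrite trC_mul hN hM !mulmxA.
Qed.

(** The trace of a product of two reflections is minus twice the inner product
    of the normals. *)
Lemma real_trace A N M : \pi_(PSL2 R) A = refl_pair N M -> \tr (val A) \is Num.real.
Proof.
have trNM : \tr (dS3val N *m \adj (dS3val M)) = - (2 * mink N M).
  by rewrite /mink; field.
have rNM : \tr (dS3val N *m \adj (dS3val M)) \is Num.real.
  by rewrite trNM realN realM ?realn// herm_mink_real ?dS3_herm.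
move=> /eqP/PSL2_eqP[] ->; first by [].
by rewrite /= raddfN /= realN.
Qed.

Lemma tr2_refl_pair N M : tr2 (refl_pair N M) \is Num.real.
Proof. by rewrite rpredX// (@real_trace _ N M)// reprK. Qed.

(** By Cayley-Hamilton, tr (A^2) = (tr A)^2 - 2. *)
Lemma tr2_sqr_refl_pair a N M : (a * a)%g = refl_pair N M -> tr2 a \is Num.real.
Proof.
rewrite -[a]reprK -pi_mulg tr2_pi; move: (repr a) => A /real_trace /=.
have CH : val A *m val A = \tr (val A) *: val A - 1%:M.
  apply/eqP; rewrite -[eqbRHS]opprB -[X in _ == - (X - _)](_ : val A *m \adj (val A) = _);
    last by rewrite mul_mx_adj det_SL2.
  by rewrite adj2 mulmxBr mul_mx_scalar addrAC subrr add0r opprK.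
rewrite CH raddfB /= linearZ /= mxtrace_scalar -expr2 => h.
by rewrite -[_ ^+ 2](subrK 2%:R) realD// realn.
Qed.

Lemma trcomm_refl_pair a b N M :
  (a * b * a^-1 * b^-1)%g = refl_pair N M -> trcomm a b \is Num.real.
Proof.
move=> h; apply: (@real_trace _ N M); rewrite -h.
by rewrite !(pi_mulg, pi_invg) !reprK.
Qed.

End Reflections.

(** * Generation *)

Section Words.
Variables (S : Type) (r0 r1 r2 r3 e : S -> S).
Hypotheses (r1K : involutive r1) (r02 : forall x, r0 (r2 x) = r2 (r0 x))
  (r01 : forall x, r0 (r1 (r0 x)) = r1 (r0 (r1 x)))
  (r12 : forall x, r1 (r2 (r1 (r2 (r1 x)))) = r2 (r1 (r2 (r1 (r2 x)))))
  (eK : involutive e) (er0 : forall x, e (r0 x) = r3 (e x))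
  (er1 : forall x, e (r1 x) = r2 (e x)) (er2 : forall x, e (r2 x) = r1 (e x)).

(** Words are compared by moving e to the right and then using the relations of
    the Coxeter group; the order 5 of r1 r2 enters only in the second one. *)
Lemma commutator_word x :
  r1 (r2 (r0 (r1 (e (r1 (r2 (r1 (r2 x)))))))) =
  r0 (r1 (r0 (r1 (e (r1 (r2 (r1 (r2 (r1 (r2 x)))))))))).
Proof. by rewrite !(er1, er2) r01 r1K r02. Qed.

Lemma square_word x :
  r0 (r1 (e (r1 (r2 (r1 (r2 (r0 (r1 (e (r1 (r2 (r1 (r2 x))))))))))))) =
  r0 (r2 (r1 (r2 (r1 (r2 (r3 (r2 (r1 (r2 (r1 (r2 x))))))))))).
Proof. by rewrite !(er0, er1, er2) eK r12. Qed.

End Words.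

Section GeneratedSubgroups.
Variable G : groupType.
Implicit Types (S H : set G) (x y : G).
Local Open Scope group_scope.

Lemma subgroupV H x : is_subgroup H -> H x -> H x^-1.
Proof. by move=> [H1 HD] Hx; have := HD _ _ H1 Hx; rewrite div1g. Qed.

Lemma subgroupM H x y : is_subgroup H -> H x -> H y -> H (x * y).
Proof.
move=> sH Hx Hy; have := sH.2 _ _ Hx (subgroupV sH Hy).
by rewrite invgK.
Qed.

Lemma gen_subgroup S : is_subgroup (gen S).
Proof.
split=> [H [[H1 _] _]//|x y Sx Sy H sH].
by apply: sH.1.2; [exact: Sx | exact: Sy].
Qed.

Lemma mem_gen S x : S x -> gen S x.
Proof. exact: sub_gen_smallest. Qed.

End GeneratedSubgroups.

Section Gamma353.
Variables (R : realType) (T : tetrahedron R) (e : PSL2 R) (c : R[i]).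
Local Notation n := (normal T).
Hypotheses (n01 : mink (n 0) (n 1) = - (1 / 2)) (n12 : mink (n 1) (n 2) = - c)
  (n02 : mink (n 0) (n 2) = 0) (c2 : 4 * c ^+ 2 = 2 * c + 1)
  (eK : involutive (act e))
  (e0 : forall X, act e (reflection (n 0) X) = reflection (n 3) (act e X))
  (e1 : forall X, act e (reflection (n 1) X) = reflection (n 2) (act e X))
  (e2 : forall X, act e (reflection (n 2) X) = reflection (n 1) (act e X)).
Local Notation a := (refl_pair (n 0) (n 1)).
Local Notation f := (refl_pair (n 1) (n 2)).
Local Notation g := (a * e * (f * f))%g.
Local Open Scope group_scope.

Lemma commutator_fg : f * g * f^-1 * g^-1 = a.
Proof.
suff -> : f * g = a * g * f by rewrite !mulgK.
apply: act_inj => X; rewrite !actM !act_refl_pair.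
apply: commutator_word => // x; first exact: reflectionK.
- exact: reflection_commute.
- exact: reflection_braid3.
Qed.

(** Here [refl_dS3 (n 2) (refl_dS3 (n 1) (n 2))] is the normal of the mirror of s,
    and the last normal that of s r_3 s. *)
Lemma sqr_g :
  g * g = refl_pair (n 0) (refl_dS3 (refl_dS3 (n 2) (refl_dS3 (n 1%R) (n 2))) (n 3)).
Proof.
apply: act_inj => X; rewrite !actM !act_refl_pair !reflection_conj.
apply: square_word => // x; exact: reflection_braid5 n12 c2.
Qed.

Lemma Delta_refl_pair i j : Delta T (refl_pair (n i) (n j)).
Proof.
rewrite /Delta /= [act _](_ : _ = reflection (n i) \o (reflection (n j) \o id)).
  by do 2!apply: reflection_groupM; exact: reflection_group1.
by apply: funext => X; rewrite act_refl_pair.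
Qed.

(** Up to a single reflection every product of reflections lies in a subgroup
    that contains the products [n 0] [n i]; by [act_neq_reflection] that single
    reflection does not occur on [Delta T]. *)
Lemma Delta_sub (H : set (PSL2 R)) : is_subgroup H ->
  (forall i, H (refl_pair (n 0) (n i))) -> (Delta T `<=` H)%classic.
Proof.
move=> sH Hi b; rewrite /Delta /= => hb.
have [u [Hu hu]] : exists u, H u /\ (act b = act u \/ act b = reflection (n 0) \o act u).
  elim: hb => [|i w _ [u [Hu hu]]].
    exists 1; split; first exact: sH.1.
    by left; apply: funext => X; rewrite act1.
  case: hu => ->.
    exists (refl_pair (n 0) (n i) * u); split; first exact: subgroupM.
    by right; apply: funext => X; rewrite /= actM act_refl_pair reflectionK.
  exists ((refl_pair (n 0) (n i))^-1 * u); split.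
    by apply: subgroupM => //; apply: subgroupV.
  left; apply: funext => X; rewrite /= actM.
  by rewrite -[LHS](actVK (refl_pair (n 0) (n i))) act_refl_pair !reflectionK.
case: hu => hu.
  by rewrite (@act_inj _ b u)// => X; rewrite hu.
case: (@act_neq_reflection _ (b * u^-1) (n 0)) => X.
by rewrite actM hu /= actKV.
Qed.

Lemma Gamma_gen : Gamma T e = gen [set f; g].
Proof.
have sH := gen_subgroup [set f; g].
have HM x y := @subgroupM _ _ x y sH; have HV x := @subgroupV _ _ x sH.
have Hf : gen [set f; g] f by apply: mem_gen; left.
have Hg : gen [set f; g] g by apply: mem_gen; right.
have Ha : gen [set f; g] a.
  have := HM _ _ (HM _ _ (HM _ _ Hf Hg) (HV _ Hf)) (HV _ Hg).
  by rewrite commutator_fg.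
have He : gen [set f; g] e.
  have eE : a^-1 * g * (f * f)^-1 = e by rewrite -(mulgA a e) mulKg mulgK.
  by have := HM _ _ (HM _ _ (HV _ Ha) Hg) (HV _ (HM _ _ Hf Hf)); rewrite eE.
have split_pair i j k :
    refl_pair (n i) (n k) = refl_pair (n i) (n j) * refl_pair (n j) (n k).
  by apply: act_inj => X; rewrite actM !act_refl_pair reflectionK.
have nn1 i : refl_pair (n i) (n i) = 1.
  by apply: act_inj => X; rewrite act1 act_refl_pair reflectionK.
have H23 : gen [set f; g] (refl_pair (n 2) (n 3)).
  have -> : refl_pair (n 2) (n 3) = e * a^-1 * e.
    rewrite (_ : a^-1 = refl_pair (n 1%R) (n 0)); last first.
      by rewrite -[LHS]mulg1 -(nn1 0) (split_pair 0 1%R 0) mulKg.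
    by apply: act_inj => X; rewrite !actM !act_refl_pair e1 e0 eK.
  exact: HM _ _ (HM _ _ He (HV _ Ha)) He.
have H02 : gen [set f; g] (refl_pair (n 0) (n 2)).
  by rewrite (split_pair 0 1%R 2); exact: HM _ _ Ha Hf.
apply/seteqP; split; apply: smallest_sub => //.
- move=> b [|->//]; apply: Delta_sub => // -[[|[|[|[|//]]]] hi].
  + by rewrite (_ : Ordinal hi = 0) ?nn1; [exact: sH.1 | exact: val_inj].
  + by rewrite (_ : Ordinal hi = 1%R)//; exact: val_inj.
  + by rewrite (_ : Ordinal hi = 2)//; exact: val_inj.
  + rewrite (_ : Ordinal hi = 3); last exact: val_inj.
    by rewrite (split_pair 0 2 3); exact: HM _ _ H02 H23.
- exact: gen_subgroup.
- have Dij i j : Gamma T e (refl_pair (n i) (n j)).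
    by apply: mem_gen; left; exact: Delta_refl_pair.
  have sG := gen_subgroup (Delta T `|` [set e]).
  have De : Gamma T e e by apply: mem_gen; right.
  have GM x y := @subgroupM _ _ x y sG.
  move=> b [|] ->; first exact: Dij.
  exact: GM _ _ (GM _ _ (Dij _ _) De) (GM _ _ (Dij _ _) (Dij _ _)).
Qed.

Lemma RP_Gamma : RP (Gamma T e).
Proof.
exists f, g; rewrite Gamma_gen; split=> //; rewrite realB ?realn//.
- exact: tr2_refl_pair.
- exact: tr2_sqr_refl_pair sqr_g.
- exact: trcomm_refl_pair commutator_fg.
Qed.

End Gamma353.

(** * The half-turn exchanges the faces *)

Lemma cos_pi_div_gt0 (R : realType) (k : nat) : (2 < k)%N -> 0 < cos (pi / k%:R) :> R.
Proof.
move=> k2; apply: cos_gt0_pihalf; rewrite (lt_trans _ (divr_gt0 (pi_gt0 R) _)) /=.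
- by rewrite ltr_pM2l ?pi_gt0// ltf_pV2 ?posrE ?ltr0n ?ltr_nat// ltnW// ltnW.
- by rewrite oppr_lt0 divr_gt0 ?pi_gt0.
- by rewrite ltr0n ltnW// ltnW.
Qed.

(** For x = pi / 3, cos (pi - x) = cos (2x); the root -1 is excluded by sign. *)
Lemma cos_pi3 (R : realType) : cos (pi / 3) = 1 / 2 :> R.
Proof.
set x : R := pi / 3; have h : cos (pi - x) = cos (x *+ 2).
  by congr cos; rewrite /x; field.
have x0 : 0 < cos x by exact: cos_pi_div_gt0.
rewrite cosB cospi sinpi cos_mulr2n in h.
have : (cos x + 1) * (2 * cos x - 1) = 0.
  transitivity (cos x ^+ 2 *+ 2 - 1 + cos x); first by ring.
  by rewrite -h; ring.
move/eqP; rewrite mulf_eq0 gt_eqF ?addr_gt0//= subr_eq0 => /eqP h2.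
by apply: (@mulfI _ 2); rewrite ?pnatr_eq0// h2; field.
Qed.

(** For x = pi / 5, cos (pi - 2x) = cos (3x); the root -1 is excluded by sign. *)
Lemma cos_pi5 (R : realType) (c : R := cos (pi / 5)) :
  0 < c /\ 4 * c ^+ 2 = 2 * c + 1.
Proof.
set x : R := pi / 5; have h : cos (pi - x *+ 2) = cos (x *+ 2 + x).
  by congr cos; rewrite /x; field.
have x0 : 0 < cos x by exact: cos_pi_div_gt0.
split=> //; rewrite /c -/x.
rewrite cosB cospi sinpi cos_mulr2n cosD cos_mulr2n sin_mulr2n in h.
have s2 := sin2cos2 x.
have : (cos x + 1) * (4 * cos x ^+ 2 - (2 * cos x + 1)) = 0.
  have -> : (cos x + 1) * (4 * cos x ^+ 2 - (2 * cos x + 1)) =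
     (cos x ^+ 2 *+ 2 - 1) * cos x - 2 * cos x * (1 - cos x ^+ 2)
      + (cos x ^+ 2 *+ 2 - 1) by ring.
  rewrite -s2; transitivity (-1 * (cos x ^+ 2 *+ 2 - 1) + 0 * (cos x * sin x *+ 2)
      + (cos x ^+ 2 *+ 2 - 1)); last by ring.
  by rewrite h; ring.
move/eqP; rewrite mulf_eq0 gt_eqF ?addr_gt0//= subr_eq0 => /eqP h2.
exact: h2.
Qed.

Section CommonPerpendicular.
Variable R : realType.
Local Notation C := R[i].
Implicit Types (X P Q : hyp3 R) (N M U V : dS3 R).

Lemma direction_herm P X : direction P X \is hermsymmx.
Proof.
by rewrite hermD ?hermZ ?hyp3_herm// herm_mink_real ?hyp3_herm.
Qed.

Lemma direction_perp P X : mink (direction P X) P = 0.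
Proof. by rewrite /direction !mink_lin hyp3_mink mulrN1 subrr. Qed.

Lemma direction_norm P X : mink (direction P X) (direction P X) = mink P X ^+ 2 - 1.
Proof.
by rewrite /direction !mink_lin !hyp3_mink (minkC X P); mink_ring.
Qed.

(** Three directions in the tangent space at [P] leave no room for a fourth: a
    tangent vector orthogonal to the edge is a combination of the normals of the
    two faces meeting there. *)
Lemma perp_edge P N M (D X : 'M[C]_2) :
  mink N M ^+ 2 != 1 -> mink P N = 0 -> mink P M = 0 ->
  mink D D != 0 -> mink D P = 0 -> mink D N = 0 -> mink D M = 0 ->
  mink X P = 0 -> mink X D = 0 ->
  exists x y, X = x *: dS3val N + y *: dS3val M.
Proof.
move=> NM PN PM DD DP DN DM XP XD.
have [W WE] : exists W : 'M[C]_2, W = dS3val M - mink N M *: dS3val N by eexists.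
have NW : mink N W = 0 by rewrite WE !mink_lin dS3_mink; mink_ring.
have W0 : mink W W != 0.
  have -> : mink W W = 1 - mink N M ^+ 2.
    by rewrite WE !mink_lin !dS3_mink (minkC M N); mink_ring.
  by rewrite subr_eq0 eq_sym.
have MP : mink W P = 0 by rewrite minkC WE !mink_lin PN PM; mink_ring.
have DW : mink W D = 0 by rewrite minkC WE !mink_lin DN DM; mink_ring.
have [y yE] : exists y, y * mink W W = mink X W.
  by exists (mink X W / mink W W); exact: divfK.
have E : X - mink X N *: dS3val N - y *: W = 0.
  apply: (orthogonal_frame (A := N) (B := W) (D := P) (E := D)); split.
  - by rewrite dS3_mink; exact: oner_neq0.
  - exact: W0.
  - by rewrite hyp3_mink oppr_eq0; exact: oner_neq0.
  - exact: DD.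
  - exact: NW.
  - by rewrite minkC.
  - by rewrite minkC.
  - exact: MP.
  - exact: DW.
  - by rewrite minkC.
  - by rewrite !mink_lin dS3_mink (minkC W N) NW; mink_ring.
  - by rewrite !mink_lin NW yE; mink_ring.
  - by rewrite !mink_lin XP MP (minkC N P) PN; mink_ring.
  - by rewrite !mink_lin XD DW (minkC N D) DN; mink_ring.
move: (mink X N) E => x E; exists (x - y * mink N M), y.
move/eqP: E; rewrite -addrA addr_eq0 => /eqP ->; rewrite WE.
by apply/matrixP => i j; rewrite !mxE; mink_ring.
Qed.

(** The half-turn about the axis of [U] and [V] is -1 on the span of [U] and [V]
    and 1 on its orthogonal, so it negates N - M and fixes N + M. *)
Lemma refl_swap N M U V (S := dS3val N + dS3val M) (D := dS3val N - dS3val M) :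
  mink U V = 0 -> mink S U = 0 -> mink S V = 0 ->
  D = mink D U *: dS3val U + mink D V *: dS3val V ->
  refl_dS3 U (refl_dS3 V N) = M.
Proof.
move=> UV SU SV E; apply: val_inj; rewrite /= /refl.
have perp (W : 'M[C]_2) : mink S W = 0 -> mink D W = 2 * mink N W.
  move=> SW; transitivity (mink D W + mink S W); last by rewrite !mink_lin; mink_ring.
  by rewrite SW addr0.
have -> : dS3val M = dS3val N - D by rewrite subKr.
rewrite E !perp// !mink_lin (minkC V U) UV.
by apply/matrixP => i j; rewrite !mxE; mink_ring.
Qed.

Lemma direction_in_plane P X N :
  mink P N = 0 -> mink X N = 0 -> mink (direction P X) N = 0.
Proof. by move=> PN XN; rewrite /direction !mink_lin PN XN; mink_ring. Qed.

Lemma direction_eq0 P X : mink (direction P X) (direction P X) = 0 ->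
  hyp3val X = - mink X P *: hyp3val P.
Proof.
have [_ h] := tangent_definite (direction_herm P X) (direction_perp P X).
move=> /h /eqP; rewrite addr_eq0 => /eqP E; rewrite scaleNr; exact: E.
Qed.

(** At least one of the two vertices on the edge differs from the foot [P], and
    thus spans its direction. *)
Lemma foot_on_edge (T : tetrahedron R) (l : set (hyp3 R)) i j k m
    (N := normal T i) (M := normal T k) :
  uniq [:: i; j; k; m] -> mink N M ^+ 2 != 1 -> orthogonal_lines l (edge T i k) ->
  exists P, [/\ l P, mink P N = 0, mink P M = 0 &
    forall X, l X -> exists x y, direction P X = x *: dS3val N + y *: dS3val M].
Proof.
move=> hu NM [P [lP eP hP]].
move: hu; rewrite /= !inE !negb_or => /and4P[/and3P[ij ik im] /andP[jk jm] km _].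
have vN r s : s != r -> mink (vertex T r) (normal T s) = 0.
  by move=> sr; rewrite minkC; exact: mink_normal_vertex.
have vE r : i != r -> k != r -> edge T i k (vertex T r).
  move=> ri rk.
  have hb : body T (vertex T r).
    move=> s; have [->|sr] := eqVneq s r; first exact/ltW/mink_normal_opp.
    by rewrite mink_normal_vertex.
  by split; split=> //=; exact: mink_normal_vertex.
have [PN PM] : mink P N = 0 /\ mink P M = 0.
  by case: eP => -[_ /= h1] [_ /= h2]; rewrite minkC h1 minkC h2.
exists P; split=> // X lX.
have [r [ri rk d0]] : exists r, [/\ i != r, k != r &
    mink (direction P (vertex T r)) (direction P (vertex T r)) != 0].
  have [dj|dj] := pselect (mink (direction P (vertex T j)) (direction P (vertex T j)) = 0).
    have [dm|dm] := pselect (mink (direction P (vertex T m)) (direction P (vertex T m)) = 0).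
      exfalso; move/direction_eq0: dj => dj; move/direction_eq0: dm => dm.
      have := mink_normal_vertex T jm.
      rewrite dm minkZr => /eqP.
      rewrite mulf_eq0 => /orP[] /eqP h0.
        have := hyp3_mink (vertex T m).
        rewrite {1}dm h0 scale0r mink0l => /esym/eqP.
        by rewrite oppr_eq0 (negPf (oner_neq0 _)).
      have := mink_normal_opp T j.
      by rewrite dj minkZr h0 mulr0 ltxx.
    by exists m; split; [exact: im | exact: km | exact/eqP].
  by exists j; split; [exact: ij | rewrite eq_sym; exact: jk | exact/eqP].
apply: (perp_edge NM PN PM d0).
- exact: direction_perp.
- exact: direction_in_plane PN (vN _ _ ri).
- exact: direction_in_plane PM (vN _ _ rk).
- exact: direction_perp.
- exact: hP lX (vE _ ri rk).
Qed.

End CommonPerpendicular.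

Section HalfTurn353.
Variables (R : realType) (N0 N1 N2 N3 : dS3 R) (c : R[i]).
Local Notation C := R[i].
Hypotheses (n01 : mink N0 N1 = - (1 / 2)) (n12 : mink N1 N2 = - c)
  (n23 : mink N2 N3 = - (1 / 2)) (n02 : mink N0 N2 = 0)
  (n03 : mink N0 N3 = 0) (n13 : mink N1 N3 = 0)
  (c0 : 0 < c) (c2 : 4 * c ^+ 2 = 2 * c + 1).

Let gram := (dS3_mink, minkC N1 N0, minkC N2 N0, minkC N3 N0, minkC N2 N1,
  minkC N3 N1, minkC N3 N2, (n01, n12, n23, n02, n03, n13)).

(** The Gram matrix is not positive semidefinite, so the four mirrors have no
    common point. *)
Lemma no_common_point (P : hyp3 R) : mink P N0 = 0 -> mink P N1 = 0 ->
  mink P N2 = 0 -> mink P N3 = 0 -> False.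
Proof.
move=> P0 P1 P2 P3.
have cR : c \is Num.real by exact: gtr0_real.
pose D := (dS3val N0 + dS3val N3) + (2 * c + 1) *: (dS3val N1 + dS3val N2).
have hD : D \is hermsymmx.
  apply: hermD; first exact: hermD (dS3_herm _) (dS3_herm _).
  apply: hermZ; first by rewrite realD ?realM ?realn.
  exact: hermD (dS3_herm _) (dS3_herm _).
have DP : mink D P = 0.
  by rewrite minkC /D !mink_lin P0 P1 P2 P3; ring.
have [D0 _] := tangent_definite hD DP.
have DD : mink D D = 1 - 2 * c.
  have tc : (2 * c + 1) * (1 - c) = 1 / 2.
    transitivity (c + 1 - (4 * c ^+ 2) / 2); first by field.
    by rewrite c2; field.
  rewrite /D !mink_lin.
  rewrite !gram.
  transitivity (2 - 2 * (2 * c + 1) + 2 * (2 * c + 1) * ((2 * c + 1) * (1 - c))).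
    by field.
  by rewrite tc; field.
have cc : (2 * c - 1) * (2 * c + 1) = 2 * c.
  by transitivity (4 * c ^+ 2 - 1); [ring | rewrite c2; ring].
have c20 : 0 < 2 * c by rewrite mulr_gt0 ?ltr0n.
have : 0 < 2 * c - 1.
  by rewrite -(pmulr_lgt0 _ (addr_gt0 c20 ltr01)) cc.
by rewrite -oppr_lt0 opprB -DD => /lt_geF; rewrite D0.
Qed.

(** The symmetry of the diagram forces the common perpendicular of the two edges
    to be symmetric: the antisymmetric parts x - y and z - w satisfy a linear
    system of determinant 4k^2 (1 + c) - 1 > 0. *)
Lemma feet_symmetric (k x y z w : C) : 0 <= k ^+ 2 - 1 ->
  k * x = - (z / 2) -> k * y = - (w / 2) ->
  k * (z - c * w) = - (x / 2) -> k * (w - c * z) = - (y / 2) -> x = y /\ z = w.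
Proof.
move=> k1 kx ky kz kw.
have zE : z = - (2 * (k * x)) by rewrite kx; field.
have wE : w = - (2 * (k * y)) by rewrite ky; field.
have : (4 * (k ^+ 2 - 1) * (1 + c) + (4 * c + 3)) * (x - y) = 0.
  transitivity (2 * (k * (w - c * z) - k * (z - c * w) - (- (y / 2) + x / 2))).
    by rewrite zE wE; field.
  by rewrite kz kw; ring.
have dpos : 0 < 4 * (k ^+ 2 - 1) * (1 + c) + (4 * c + 3).
  rewrite ltr_wpDl// ?addr_gt0 ?mulr_gt0 ?ltr0n//.
  by rewrite mulr_ge0// ?mulr_ge0 ?ler0n// addr_ge0 ?ler01// ltW.
move/eqP; rewrite mulf_eq0 (gt_eqF dpos) subr_eq0 => /eqP xy.
by split=> //; rewrite zE wE xy.
Qed.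

(** The feet of the axis supply an orthogonal frame U, V, P, Q + kP, in which
    the differences of the exchanged normals have no component along the last two
    vectors. *)
Lemma half_turn_swap (U V : dS3 R) (P Q : hyp3 R) :
  mink U V = 0 -> axis U V P -> axis U V Q ->
  mink P N0 = 0 -> mink P N3 = 0 -> mink Q N1 = 0 -> mink Q N2 = 0 ->
  (exists x y, direction P Q = x *: dS3val N0 + y *: dS3val N3) ->
  (exists z w, direction Q P = z *: dS3val N1 + w *: dS3val N2) ->
  refl_dS3 U (refl_dS3 V N0) = N3 /\ refl_dS3 U (refl_dS3 V N1) = N2.
Proof.
move=> UV [PU PV] [QU QV] P0 P3 Q1 Q2 [x [y dE]] [z [w d'E]].
have dirU : mink (direction P Q) U = 0 by exact: direction_in_plane.
have dirV : mink (direction P Q) V = 0 by exact: direction_in_plane.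
have dir'U : mink (direction Q P) U = 0 by exact: direction_in_plane.
have dir'V : mink (direction Q P) V = 0 by exact: direction_in_plane.
have dP : mink (direction P Q) P = 0 by exact: direction_perp.
have [k1 kd] := tangent_definite (direction_herm P Q) (direction_perp P Q).
have k1E := direction_norm P Q.
have [k kE] : exists k, mink P Q = k by eexists.
have dN (W : dS3 R) : mink Q W + k * mink P W = x * mink N0 W + y * mink N3 W.
  by have := congr1 (fun D => mink D W) dE;
    rewrite /direction (minkC Q P) kE !mink_lin.
have d'N (W : dS3 R) : mink P W + k * mink Q W = z * mink N1 W + w * mink N2 W.
  by have := congr1 (fun D => mink D W) d'E; rewrite /direction kE !mink_lin.
have Q0 : mink Q N0 = x.
  transitivity (mink Q N0 + k * mink P N0); first by rewrite P0; mink_ring.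
  by rewrite dN !gram; ring.
have Q3 : mink Q N3 = y.
  transitivity (mink Q N3 + k * mink P N3); first by rewrite P3; mink_ring.
  by rewrite dN !gram; ring.
have P1 : mink P N1 = z - c * w.
  transitivity (mink P N1 + k * mink Q N1); first by rewrite Q1; mink_ring.
  by rewrite d'N !gram; ring.
have P2 : mink P N2 = w - c * z.
  transitivity (mink P N2 + k * mink Q N2); first by rewrite Q2; mink_ring.
  by rewrite d'N !gram; ring.
have kx : k * x = - (z / 2).
  transitivity (mink P N0 + k * mink Q N0); first by rewrite P0 Q0 add0r.
  by rewrite d'N !gram; field.
have ky : k * y = - (w / 2).
  transitivity (mink P N3 + k * mink Q N3); first by rewrite P3 Q3 add0r.
  by rewrite d'N !gram; field.
have kz : k * (z - c * w) = - (x / 2).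
  transitivity (mink Q N1 + k * mink P N1); first by rewrite Q1 P1 add0r.
  by rewrite dN !gram; field.
have kw : k * (w - c * z) = - (y / 2).
  transitivity (mink Q N2 + k * mink P N2); first by rewrite Q2 P2 add0r.
  by rewrite dN !gram; field.
have [xy zw] : x = y /\ z = w.
  apply: feet_symmetric kx ky kz kw.
  by rewrite -kE -direction_norm.
have dEx : direction P Q = x *: (dS3val N0 + dS3val N3) 
  by rewrite dE -xy scalerDr.
have d'Ez : direction Q P = z *: (dS3val N1 + dS3val N2) 
  by rewrite d'E -zw scalerDr.
have x0 : x != 0.
  apply/eqP => x0; have y0 : y = 0 by rewrite -xy.
  exact: no_common_point (etrans Q0 x0) Q1 Q2 (etrans Q3 y0).
have z0 : z != 0.
  apply: contra_neq x0 => z0; move: kz; rewrite -zw z0 mulr0 subr0 mulr0 => /esym/eqP.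
  by rewrite oppr_eq0 mulf_eq0 invr_eq0 pnatr_eq0 orbF => /eqP.
have perp (a : C) (D : 'M[C]_2) (W : dS3 R) : a != 0 -> mink (a *: D) W = 0 -> mink D W = 0.
  move=> a0; rewrite minkZl; move: (mink D W) => b /eqP.
  by rewrite mulf_eq0 (negPf a0) => /eqP.
have dd : mink (direction P Q) (direction P Q) != 0.
  rewrite dEx !mink_lin !gram.
  have -> : x * (x * (1 + 0) + x * (0 + 1)) = 2 * x ^+ 2 by ring.
  by rewrite mulf_neq0 ?expf_neq0// pnatr_eq0.
have span (D : 'M[C]_2) : mink D P = 0 -> mink D (direction P Q) = 0 ->
    D = mink D U *: dS3val U + mink D V *: dS3val V.
  move=> DP; move: (direction P Q) dd dP dirU dirV => d dd dP dirU dirV DD.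
  have E : D - mink D U *: dS3val U - mink D V *: dS3val V = 0.
    apply: (orthogonal_frame (A := U) (B := V) (D := P) (E := d)); split.
    - by rewrite dS3_mink; exact: oner_neq0.
    - by rewrite dS3_mink; exact: oner_neq0.
    - by rewrite hyp3_mink oppr_eq0; exact: oner_neq0.
    - exact: dd.
    - exact: UV.
    - by rewrite minkC.
    - by rewrite minkC.
    - by rewrite minkC.
    - by rewrite minkC.
    - by rewrite minkC.
    - by rewrite !mink_lin dS3_mink (minkC V U) UV; mink_ring.
    - by rewrite !mink_lin dS3_mink UV; mink_ring.
    - by rewrite !mink_lin DP (minkC U P) (minkC V P) PU PV; mink_ring.
    - by rewrite !mink_lin DD (minkC U d) dirU (minkC V d) dirV; mink_ring.
  move/eqP: E; rewrite -addrA addr_eq0 => /eqP E.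
  by rewrite [LHS]E opprD !opprK.
have SU : mink (dS3val N0 + dS3val N3) U = 0 
  by apply: (perp _ _ _ x0); rewrite -dEx; exact: dirU.
have SV : mink (dS3val N0 + dS3val N3) V = 0 
  by apply: (perp _ _ _ x0); rewrite -dEx; exact: dirV.
have S'U : mink (dS3val N1 + dS3val N2) U = 0 
  by apply: (perp _ _ _ z0); rewrite -d'Ez; exact: dir'U.
have S'V : mink (dS3val N1 + dS3val N2) V = 0 
  by apply: (perp _ _ _ z0); rewrite -d'Ez; exact: dir'V.
split; [apply: (refl_swap UV SU SV) | apply: (refl_swap UV S'U S'V)]; apply: span.
- by rewrite minkC !mink_lin P0 P3 subrr.
- by rewrite dEx !mink_lin !gram; ring.
- by rewrite minkC !mink_lin P1 P2 zw subrr.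
- by rewrite dEx !mink_lin !gram; field.
Qed.

End HalfTurn353.

Lemma rotation_pi (R : realType) (U V : dS3 R) (X : 'M[R[i]]_2) :
  mink U V = 0 -> rotation U V pi X = refl U (refl V X).
Proof.
move=> UV; rewrite /rotation cospi sinpi /refl !mink_lin (minkC V U) UV.
by rewrite rmorphN rmorph1 rmorph0; apply/matrixP => i j; rewrite !mxE; mink_ring.
Qed.

Lemma half_turn_reflections (R : realType) (U V : dS3 R) (e : PSL2 R) :
  mink U V = 0 -> (forall X : hyp3 R, hyp3val (act e X) = rotation U V pi X) ->
  forall X, act e X = reflection U (reflection V X).
Proof. by move=> UV he X; apply: val_inj; exact: etrans (he X) (rotation_pi X UV). Qed.

Lemma half_turn_conj (R : realType) (U V N M : dS3 R) (X : hyp3 R) :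
  refl_dS3 U (refl_dS3 V N) = M ->
  reflection U (reflection V (reflection N X)) =
  reflection M (reflection U (reflection V X)).
Proof.
move=> <-; rewrite (reflection_conj U) (reflection_conj V).
by rewrite (reflectionK U) (reflectionK V).
Qed.

Unset Implicit Arguments.

Theorem corollary1 (R : realType) (T : tetrahedron R) (l : set (hyp3 R))
    (e : PSL2 R) :
  coxeter353 T ->
  half_turn l e -> orthogonal_lines l (edge T 0 3) -> orthogonal_lines l (edge T 1 2) ->
  RP (Gamma T e).
Proof.
move=> [[[_ n01] [_ n12] [_ n23]] [[_ n02] [_ n03] [_ n13]]] [U [V [UV lE he]]] l03 l12.
have cC3 : (cos (pi / 3 : R))%:C%C = 1 / 2 by rewrite cos_pi3 fmorph_div rmorph1 rmorph_nat.
rewrite cC3 in n01 n23; rewrite cos_pihalf rmorph0 oppr0 in n02 n03 n13.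
have [cR0 cR2] := cos_pi5 R.
move: (cos (pi / 5)) cR0 cR2 n12 => cR cR0 cR2 n12.
have c0 : 0 < cR%:C%C by rewrite ltcR.
have c2 : 4 * cR%:C%C ^+ 2 = 2 * cR%:C%C + 1.
  by have := congr1 (real_complex R) cR2;
    rewrite !(rmorphM, rmorphD, rmorphXn, rmorph_nat, rmorph1).
move: (cR%:C%C) c0 c2 n12 => c c0 c2 n12.
have [P [lP P0 P3 dP]] : exists P, [/\ l P, mink P (normal T 0) = 0, mink P (normal T 3) = 0 &
    forall X, l X -> exists x y,
      direction P X = x *: dS3val (normal T 0) + y *: dS3val (normal T 3)].
  apply: (@foot_on_edge _ T l 0 1 3 2) l03 => //.
  by rewrite n03 expr0n eq_sym oner_neq0.
have [Q [lQ Q1 Q2 dQ]] : exists Q, [/\ l Q, mink Q (normal T 1) = 0, mink Q (normal T 2) = 0 &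
    forall X, l X -> exists x y,
      direction Q X = x *: dS3val (normal T 1) + y *: dS3val (normal T 2)].
  apply: (@foot_on_edge _ T l 1 0 2 3) l12 => //.
  (* c^2 = 1 would give 2c = 3, whose square is not 4c^2 = 4. *)
  rewrite n12 sqrrN; apply/eqP => c21; rewrite c21 mulr1 in c2.
  have c3 : 2 * c = 3 by apply: (addIr 1); rewrite -c2; ring.
  have : (2 * c) ^+ 2 = 4 * c ^+ 2 by ring.
  by rewrite c3 c21 mulr1 -natrX => /eqP; rewrite eqr_nat.
have [] := half_turn_swap n01 n12 n23 n02 n03 n13 c0 c2 UV _ _ P0 P3 Q1 Q2 (dP _ lQ) (dQ _ lP).
- by rewrite -lE.
- by rewrite -lE.
move=> s0 s1; have eE := half_turn_reflections UV he.
have VU : mink V U = 0 by rewrite minkC.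
have eK : involutive (act e).
  move=> X; rewrite (eE (act e X)) (eE X) (reflection_commute (reflection V X) VU).
  by rewrite (reflectionK V) (reflectionK U).
have e0 X : act e (reflection (normal T 0) X) = reflection (normal T 3) (act e X).
  by rewrite (eE X) (eE (reflection _ _)); exact: half_turn_conj s0.
have e1 X : act e (reflection (normal T 1) X) = reflection (normal T 2) (act e X).
  by rewrite (eE X) (eE (reflection _ _)); exact: half_turn_conj s1.
have e2 X : act e (reflection (normal T 2) X) = reflection (normal T 1) (act e X).
  by rewrite -{1}(eK X) -(e1 (act e X)) eK.
exact: RP_Gamma n01 n12 n02 c2 eK e0 e1 e2.
Qed.
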